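(* Let $(\Omega,\mathcal F)$ be a measurable space and let $\succeq$ be a preference order on $\mathcal L^\infty(\Omega,\mathcal F)$ satisfying (SM) and (PC). Then the following are equivalent: (i) $\succeq$ satisfies (ST); (ii) every representing functional $T$ for $\succeq$ is conditionable, i.e. conditionable on every sub-$\sigma$-algebra $\mathcal G\subseteq\mathcal F$; (iii) every representing functional $T$ for $\succeq$ is conditionable on $\sigma(A)=\{\varnothing,\Omega,A,A^c\}$ for every $A\in\mathcal F$.
   Context: $\mathcal L^\infty(\Omega,\mathcal F)$ is the set of bounded $\mathcal F$-measurable functions $\Omega\to\mathbb R$ (bounded everywhere); constants $x\in\mathbb R$ are identified with constant functions. A preference order $\succeq$ is a complete and transitive binary relation on it; $f\succ g$ means $f\succeq g$ and not $g\succeq f$; $f\sim g$ means $f\succeq g$ and $g\succeq f$. The null events are $\mathcal N_\succeq=\{A\in\mathcal F: f1_A+g1_{A^c}\sim g\ \forall f,g\}$; an event is non-null if it is not in $\mathcal N_\succeq$. (SM): for every non-null $A\in\mathcal F$, every $f$ and constants $x>y$: $x1_A+f1_{A^c}\succ y1_A+f1_{A^c}$. (ST): for all $f,g,h$ and $A\in\mathcal F$, if $f1_A+h1_{A^c}\succeq g1_A+h1_{A^c}$ then $f1_A+\tilde h1_{A^c}\succeq g1_A+\tilde h1_{A^c}$ for every $\tilde h$. (PC): for every uniformly bounded sequence $(f_n)$ with $f_n(\omega)\to f(\omega)$ for all $\omega$, and every $g$ with $g\succ f$ (resp. $f\succ g$), there is $N$ with $g\succ f_n$ (resp. $f_n\succ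 g$) for all $n>N$. A functional $T:\mathcal L^\infty(\Omega,\mathcal F)\to\mathbb R$ represents $\succeq$ if $T(f)\ge T(g)\iff f\succeq g$. $T$ is conditionable on a sub-$\sigma$-algebra $\mathcal G$ if for every $f\in\mathcal L^\infty(\Omega,\mathcal F)$ there exists $g\in\mathcal L^\infty(\Omega,\mathcal G)$ with $T(f1_A)=T(g1_A)$ for all $A\in\mathcal G$. *)

(* Defs.v *)
From HB Require Import structures.
From mathcomp Require Import all_boot all_order all_algebra.
From mathcomp Require Import all_classical all_reals all_analysis.
Set Implicit Arguments. Unset Strict Implicit. Unset Printing Implicit Defensive.
Import Order.TTheory GRing.Theory Num.Theory.
Import numFieldNormedType.Exports.
Local Open Scope classical_set_scope.
Local Open Scope ring_scope.

Section Defs.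
Context {d : measure_display} {Omega : measurableType d} {R : realType}.

Definition G_measurable (G : set (set Omega)) (f : Omega -> R) : Prop :=
  forall B : set R, measurable B -> G (f @^-1` B).

Definition Linf (G : set (set Omega)) (f : Omega -> R) : Prop :=
  (exists M : R, forall w, `|f w| <= M) /\ G_measurable G f.

Definition LinfF : (Omega -> R) -> Prop := Linf measurable.

Definition is_sub_sigma_algebra (G : set (set Omega)) : Prop :=
  sigma_algebra setT G /\ G `<=` measurable.

Definition sigma_of (A : set Omega) : set (set Omega) :=
  [set set0; setT; A; ~` A].

Definition mix (A : set Omega) (f g : Omega -> R) : Omega -> R :=
  fun w => f w * \1_A w + g w * \1_(~` A) w.

Definition restr (f : Omega -> R) (A : set Omega) : Omega -> R :=
  fun w => f w * \1_A w.

Variable pref : (Omega -> R) -> (Omega -> R) -> Prop.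

Definition spref (f g : Omega -> R) : Prop := pref f g /\ ~ pref g f.
Definition indiff (f g : Omega -> R) : Prop := pref f g /\ pref g f.

Definition preference_order : Prop :=
  (forall f g, LinfF f -> LinfF g -> pref f g \/ pref g f) /\
  (forall f g h, LinfF f -> LinfF g -> LinfF h ->
     pref f g -> pref g h -> pref f h).

Definition null_event (A : set Omega) : Prop :=
  measurable A /\
  forall f g, LinfF f -> LinfF g -> indiff (mix A f g) g.

Definition SM : Prop :=
  forall A : set Omega, measurable A -> ~ null_event A ->
  forall f, LinfF f -> forall x y : R, x > y ->
    spref (mix A (cst x) f) (mix A (cst y) f).

Definition ST : Prop :=
  forall f g h A, LinfF f -> LinfF g -> LinfF h -> measurable A ->
    pref (mix A f h) (mix A g h) ->
    forall h', LinfF h' -> pref (mix A f h') (mix A g h').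

Definition PC : Prop :=
  forall (fs : nat -> Omega -> R) (f : Omega -> R),
    (forall n, LinfF (fs n)) -> LinfF f ->
    (exists M : R, forall n w, `|fs n w| <= M) ->
    (forall w, (fun n => fs n w) @ \oo --> f w) ->
    forall g, LinfF g ->
      (spref g f -> exists N : nat, forall n, (N < n)%N -> spref g (fs n)) /\
      (spref f g -> exists N : nat, forall n, (N < n)%N -> spref (fs n) g).

Definition represents (T : (Omega -> R) -> R) : Prop :=
  forall f g, LinfF f -> LinfF g -> (T f >= T g <-> pref f g).

End Defs.

Definition conditionable {d : measure_display} {Omega : measurableType d}
  {R : realType} (T : (Omega -> R) -> R) (G : set (set Omega)) : Prop :=
  forall f, LinfF f -> exists g, Linf G g /\
    forall A, G A -> T (restr f A) = T (restr g A).

(* Main.v *)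
(* By (PC) the order is closed under bounded pointwise limits, and with (SM) it is
   monotone: compare step functions cell by cell and pass to the limit. If the
   whole space is not null, certainty equivalents exist and give a representing
   functional T.

   Conditionability on sigma(A) makes f 1_A + h 1_{A^c} indifferent to
   a 1_A + b 1_{A^c} with a depending only on f and b only on h (uniqueness of a
   and b being (SM)), which yields (ST).

   Conversely (ST) turns "u is preferred to v on A" into a relation that is
   complete and countably additive in A. A greedy exhaustion then gives a Hahn
   decomposition: for every q some A_q in G has f preferred to q on every
   G-subset of A_q and q preferred to f on every G-subset of its complement. The
   function g = sup {q rational | w in A_q} is G-measurable, f is preferred to s
   on G-subsets of {g >= s} and t to f on G-subsets of {g <= t}; slicing A into
   cells on which g varies by at most e and letting e tend to 0 shows that f 1_A
   and g 1_A are indifferent for all A in G. *)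
Require Import Defs.
From mathcomp Require Import all_boot all_order all_algebra.
From mathcomp Require Import all_classical all_reals all_analysis.
From mathcomp Require Import lra.
Set Implicit Arguments. Unset Strict Implicit. Unset Printing Implicit Defensive.
Import Order.TTheory GRing.Theory Num.Theory.
Import numFieldNormedType.Exports.
Local Open Scope classical_set_scope.
Local Open Scope ring_scope.

(** * Convergence criteria for real sequences *)

Section limits.
Context {R : realType}.

Lemma cvg_eventually_eq (u : nat -> R) (l : R) (N : nat) :
  (forall n, (N <= n)%N -> u n = l) -> u @ \oo --> l.
Proof.
move=> ul; apply: (@cvg_trans _ ((fun=> l) @ \oo)); last exact: cvg_cst.
apply: near_eq_cvg; near=> n; rewrite ul//; near: n; exact: nbhs_infty_ge.
Unshelve. all: by end_near. Qed.

Lemma cvg_dist_harmonic (u : nat -> R) (l : R) :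
  (forall n, `|u n - l| <= n.+1%:R^-1) -> u @ \oo --> l.
Proof.
move=> ul; have h0 := @cvg_harmonic R.
apply: (@squeeze_cvgr _ _ _ _ (fun n => l - harmonic n) (fun n => l + harmonic n)).
- near=> n; have := ul n; rewrite ler_distl => /andP[? ?]; exact/andP.
- by rewrite -[X in _ --> X]subr0; apply: cvgB => //; exact: cvg_cst.
- by rewrite -[X in _ --> X]addr0; apply: cvgD => //; exact: cvg_cst.
Unshelve. all: by end_near. Qed.

End limits.

(** * Closure and measurability for a sigma-algebra [G]; discretisation of bounded functions *)

Section sigma_algebras.
Context {d : measure_display} {Omega : measurableType d}.
Variable G : set (set Omega).
Hypothesis sG : sigma_algebra setT G.

Lemma sigma_set0 : G set0. Proof. by case: sG. Qed.

Lemma sigma_setC A : G A -> G (~` A).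
Proof. by case: sG => _ h _ /h; rewrite setTD. Qed.

Lemma sigma_setT : G setT.
Proof. rewrite -setC0; exact/sigma_setC/sigma_set0. Qed.

Lemma sigma_bigcup (F : nat -> set Omega) :
  (forall n, G (F n)) -> G (\bigcup_n F n).
Proof. by case: sG => _ _; apply. Qed.

Lemma sigma_setU A B : G A -> G B -> G (A `|` B).
Proof.
move=> GA GB; rewrite -bigcup2E; apply: sigma_bigcup => -[|[|n]]//=.
exact: sigma_set0.
Qed.

Lemma sigma_setI A B : G A -> G B -> G (A `&` B).
Proof.
by move=> GA GB; rewrite -[A `&` B]setCK setCI; apply/sigma_setC/sigma_setU; exact/sigma_setC.
Qed.

Lemma sigma_setD A B : G A -> G B -> G (A `\` B).
Proof. by move=> GA GB; rewrite setDE; exact/sigma_setI/sigma_setC. Qed.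

Context {R : realType}.

Lemma Linf_cst (x : R) : Linf G (cst x).
Proof.
split; first by exists `|x|.
move=> B _; rewrite preimage_cst; case: ifP => _; [exact: sigma_setT|exact: sigma_set0].
Qed.

Lemma mixE A (f g : Omega -> R) : mix A f g = fun w => if `[< A w >] then f w else g w.
Proof.
apply/funext => w; rewrite /mix !indicE in_setC.
by rewrite /in_mem/= /in_set/=; case: asboolP => _; rewrite /= !mulr1 !mulr0 ?addr0 ?add0r.
Qed.

Lemma restr_mix A (f : Omega -> R) : restr f A = mix A f (cst 0).
Proof. by apply/funext => w; rewrite /restr /mix /= mul0r addr0. Qed.

Lemma Linf_mix A (f g : Omega -> R) : G A -> Linf G f -> Linf G g -> Linf G (mix A f g).
Proof.
move=> GA [[M fM] mf] [[N gN] mg]; split.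
  exists (Num.max M N) => w; rewrite mixE le_max.
  by case: ifP => _; rewrite ?fM ?gN ?orbT.
move=> B mB; have -> : mix A f g @^-1` B = (A `&` f @^-1` B) `|` (~` A `&` g @^-1` B).
  rewrite mixE; apply/seteqP; split => w /=; case: asboolP => Aw.
  - by left.
  - by right.
  - by case=> -[].
  - by case=> -[].
by apply: sigma_setU; apply: sigma_setI; [|exact: mf|exact: sigma_setC|exact: mg].
Qed.

Lemma G_measurable_countable (c : Omega -> nat) (a : nat -> R) :
  (forall k, G (c @^-1` [set k])) -> G_measurable G (a \o c).
Proof.
move=> Gc B _.
have -> : (a \o c) @^-1` B = \bigcup_k (if `[< B (a k) >] then c @^-1` [set k] else set0).
  apply/seteqP; split => w /=.
    by move=> Bw; exists (c w) => //; case: asboolP.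
  by case=> k _; case: asboolP => //= Bk ->.
by apply: sigma_bigcup => k; case: ifP => _; [exact: Gc|exact: sigma_set0].
Qed.

(** The sets whose preimage lies in [G] form a sigma-algebra, and the open rays generate the Borel
    sets. *)
Lemma G_measurable_gt (g : Omega -> R) :
  (forall t, G [set w | t < g w]) -> G_measurable G g.
Proof.
move=> Gg B mB.
suff: (@measurable_realfun.RGenOInfty.G R).-sigma.-measurable `<=` [set B | G (g @^-1` B)].
  by apply; rewrite -measurable_realfun.RGenOInfty.measurableE.
apply: smallest_sub.
  split => /=.
  - by rewrite preimage_set0; exact: sigma_set0.
  - by move=> A; rewrite setTD preimage_setC; exact: sigma_setC.
  - by move=> F GF; rewrite preimage_bigcup; exact: sigma_bigcup.
move=> _ [t ->] /=; have -> : g @^-1` `]t, +oo[ = [set w | t < g w]; last exact: Gg.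
by apply/seteqP; split => w /=; rewrite in_itv/= andbT.
Qed.

Lemma G_measurable_addr (g : Omega -> R) (x : R) :
  G_measurable G g -> G_measurable G (fun w => g w + x).
Proof.
move=> mg; apply: G_measurable_gt => t.
have -> : [set w | t < g w + x] = g @^-1` `]t - x, +oo[.
  by apply/seteqP; split => w /=; rewrite in_itv/= andbT ltrBlDr.
by apply: mg; exact: measurable_itv.
Qed.

(** Cells of width [e] are counted upward from [- M]. When [M] bounds [u], the shift keeps the
    quotient nonnegative, so truncation is a floor. *)
Definition grid (u : Omega -> R) (M e : R) (w : Omega) : nat :=
  Num.truncn ((u w + M) / e).

Lemma grid_itv (u : Omega -> R) (M e : R) w : 0 < e -> (forall w, `|u w| <= M) ->
  (grid u M e w)%:R * e - M <= u w < (grid u M e w)%:R * e - M + e.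
Proof.
move=> e0 uM; have uM0 : 0 <= (u w + M) / e.
  apply: divr_ge0; last exact: ltW.
  by have := uM w; rewrite ler_norml => /andP[]; lra.
have := truncn_itv uM0; rewrite -/(grid u M e w).
rewrite ler_pdivlMr// ltr_pdivrMr// -natr1 mulrDl mul1r => /andP[? ?].
by apply/andP; split; lra.
Qed.

Lemma grid_measurable (u : Omega -> R) (M e : R) k : 0 < e ->
  (forall w, `|u w| <= M) -> G_measurable G u -> G (grid u M e @^-1` [set k]).
Proof.
move=> e0 uM mu.
have -> : grid u M e @^-1` [set k] = u @^-1` `[k%:R * e - M, k%:R * e - M + e[.
  apply/seteqP; split => w /=; rewrite in_itv/=.
    by move=> <-; exact: grid_itv.
  move=> /andP[h1 h2]; apply: truncn_def.
  rewrite ler_pdivlMr// ltr_pdivrMr// -natr1 mulrDl mul1r; apply/andP; split; lra.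
by apply: mu; exact: measurable_itv.
Qed.

End sigma_algebras.
Ltac mix_cases :=
  rewrite ?mixE; apply/funext => w /=; repeat (case: asboolP => ?);
  unfold setU, setD, setI, setC, setT, mkset in *; try done; exfalso; tauto.

(** * The sigma-algebra generated by one event *)

Section sigma_of.
Context {d : measure_display} {Omega : measurableType d} {R : realType}.

(** The atoms are [A] and its complement, so [B] is determined by which of the two it meets. In this
    saturated form the closure properties become immediate. *)
Lemma sigma_ofP (A B : set Omega) :
  sigma_of A B <-> (forall w w', (A w <-> A w') -> B w -> B w').
Proof.
split=> [|sat].
  rewrite /sigma_of => -[[[->|->]|->]|->] w w' //= ww'; tauto.
have [[a [Aa Ba]]|nA] := pselect (exists a, A a /\ B a);
  have [[b [Ab Bb]]|nB] := pselect (exists b, ~ A b /\ B b).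
- left; left; right; apply/seteqP; split=> // w _.
  by have [Aw|nAw] := pselect (A w); [apply: sat Ba|apply: sat Bb]; tauto.
- left; right; apply/seteqP; split=> w => [Bw|Aw].
    by apply: contrapT => nAw; apply: nB; exists w.
  by apply: sat Ba; tauto.
- right; apply/seteqP; split=> w => [Bw Aw|nAw]; first by apply: nA; exists w.
  by apply: sat Bb; rewrite /setC /= in nAw; tauto.
- left; left; left; apply/seteqP; split=> // w Bw.
  by have [Aw|nAw] := pselect (A w); [apply: nA|apply: nB]; exists w.
Qed.

Lemma sigma_of_sub_sigma_algebra (A : set Omega) :
  measurable A -> is_sub_sigma_algebra (sigma_of A).
Proof.
move=> mA; split; last first.
  move=> B; rewrite /sigma_of => -[[[->|->]|->]|->] //; exact: measurableC.
split.
- by apply/sigma_ofP.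
- move=> B /sigma_ofP sB; apply/sigma_ofP => w w' ww' [_ nBw]; split=> // Bw'.
  by apply: nBw; apply: sB Bw'; tauto.
- move=> F sF; apply/sigma_ofP => w w' ww' [n _ Fw]; exists n => //.
  by have /sigma_ofP/(_ w w' ww') := sF n; apply.
Qed.

Lemma sigma_of_const (A : set Omega) (g : Omega -> R) w w' :
  Linf (sigma_of A) g -> (A w <-> A w') -> g w = g w'.
Proof.
move=> [_ mg] ww'; have /sigma_ofP/(_ w w' ww' erefl) := mg [set g w] (measurable_set1 _).
by move=> ->.
Qed.

End sigma_of.

(** * Limits and monotonicity of the order *)

Section preferences.
Context {d : measure_display} {Omega : measurableType d} {R : realType}.
Variable pref : (Omega -> R) -> (Omega -> R) -> Prop.
Hypotheses (po : preference_order pref) (sm : SM pref) (pc : PC pref).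
Implicit Types (f g h u v : Omega -> R) (A B C : set Omega).

Let sF : sigma_algebra setT (@measurable d Omega) := sigma_algebra_measurable Omega.

Lemma LinfF_cst (x : R) : LinfF (cst x : Omega -> R).
Proof. exact: Linf_cst. Qed.

Lemma LinfF_mix A f g : measurable A -> LinfF f -> LinfF g -> LinfF (mix A f g).
Proof. exact: Linf_mix. Qed.

Hint Resolve LinfF_cst LinfF_mix : core.

Lemma pref_total f g : LinfF f -> LinfF g -> pref f g \/ pref g f.
Proof. case: po => tot _; exact: tot. Qed.

Lemma pref_refl f : LinfF f -> pref f f.
Proof. by move=> Lf; case: (pref_total Lf Lf). Qed.

Lemma pref_trans g f h : LinfF f -> LinfF g -> LinfF h ->
  pref f g -> pref g h -> pref f h.
Proof. case: po => _; exact. Qed.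

Lemma prefNspref f g : LinfF f -> LinfF g -> ~ pref f g -> spref pref g f.
Proof. by move=> Lf Lg nfg; split => //; case: (pref_total Lf Lg). Qed.

(** Otherwise [g] is strictly above [f] by completeness, and (PC) puts [g] strictly above some
    [fs n]. *)
Lemma pref_lim_l (fs : nat -> Omega -> R) f g :
  (forall n, LinfF (fs n)) -> LinfF f -> LinfF g ->
  (exists M, forall n w, `|fs n w| <= M) ->
  (forall w, fs ^~ w @ \oo --> f w) -> (forall n, pref (fs n) g) -> pref f g.
Proof.
move=> Lfs Lf Lg bd cv fg; apply: contrapT => /(prefNspref Lf Lg) gf.
have [/(_ gf)[N /(_ N.+1 (ltnSn _))[_ nfg]] _] := pc Lfs Lf bd cv Lg.
exact/nfg/fg.
Qed.

Lemma pref_lim_r (fs : nat -> Omega -> R) f g :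
  (forall n, LinfF (fs n)) -> LinfF f -> LinfF g ->
  (exists M, forall n w, `|fs n w| <= M) ->
  (forall w, fs ^~ w @ \oo --> f w) -> (forall n, pref g (fs n)) -> pref g f.
Proof.
move=> Lfs Lf Lg bd cv fg; apply: contrapT => /(prefNspref Lg Lf) gf.
have [_ /(_ gf)[N /(_ N.+1 (ltnSn _))[_ nfg]]] := pc Lfs Lf bd cv Lg.
exact/nfg/fg.
Qed.

Lemma pref_mix_cst A f (x y : R) : measurable A -> LinfF f -> y <= x ->
  pref (mix A (cst x) f) (mix A (cst y) f).
Proof.
move=> mA Lf; rewrite le_eqVlt => /predU1P[->|yx]; first exact/pref_refl/LinfF_mix.
case: (pselect (null_event pref A)) => [[_ nA]|nA]; last by have [] := sm mA nA Lf yx.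
have [xf _] := nA (cst x) f (LinfF_cst x) Lf.
have [_ fy] := nA (cst y) f (LinfF_cst y) Lf.
by apply: pref_trans xf fy; auto.
Qed.

Lemma pref_step (c : Omega -> nat) (a b : nat -> R) (M : R) :
  (forall k, measurable (c @^-1` [set k])) ->
  (forall w, b (c w) <= a (c w)) ->
  (forall w, `|a (c w)| <= M) -> (forall w, `|b (c w)| <= M) ->
  pref (a \o c) (b \o c).
Proof.
move=> mc ba aM bM.
(* [h] passes from [b] to [a] one cell at a time; at each point it is eventually constant. *)
pose h n w := if (c w < n)%N then a (c w) else b (c w).
have hM n w : `|h n w| <= M by rewrite /h; case: ifP.
have Lh n : LinfF (h n).
  split; first by exists M.
  exact: (@G_measurable_countable _ _ _ sF _ c (fun k => if (k < n)%N then a k else b k)).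
have La : LinfF (a \o c) by split; [exists M|exact: G_measurable_countable].
have Lb : LinfF (b \o c) by split; [exists M|exact: G_measurable_countable].
apply: (@pref_lim_l h) => //; first by exists M.
  move=> w; apply: (@cvg_eventually_eq _ _ _ (c w).+1) => n cn.
  by rewrite /h cn.
elim=> [|n ih]; first exact: pref_refl.
apply: pref_trans (_ : pref (h n.+1) (h n)) ih => //.
have [|ab] := lerP (b n) (a n).
  move=> /(pref_mix_cst (mc n) (Lh n)).
  congr pref; rewrite mixE; apply/funext => w /=; case: asboolP => [|/eqP].
  - by move=> <-; rewrite /h ltnSn.
  - by rewrite /h ltnS [in RHS]leq_eqVlt => /negbTE ->.
  - by move=> <-; rewrite /h ltnn.
  - by [].
(* Here [a n < b n], so no point has index [n]: the cell is empty and nothing changes. *)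
suff -> : h n.+1 = h n by exact: pref_refl.
apply/funext => w; rewrite /h ltnS [in LHS]leq_eqVlt; case: eqP => //= cn.
by have := ba w; rewrite cn leNgt ab.
Qed.

Lemma pref_mono u v : LinfF u -> LinfF v -> (forall w, v w <= u w) -> pref u v.
Proof.
move=> Lu Lv vu.
have [[M0 uM0] mu] := Lu; have [[N0 vN0] mv] := Lv.
pose M := Num.max M0 N0.
have uM w : `|u w| <= M by rewrite le_max uM0.
have vM w : `|v w| <= M by rewrite le_max vN0 orbT.
pose e n : R := n.+1%:R^-1.
have e0 n : 0 < e n by rewrite invr_gt0.
have e1 n : e n <= 1 by rewrite invf_le1// ler1n.
pose U n w := (grid u M (e n) w)%:R * e n - M + e n.
pose V n w := (grid v M (e n) w)%:R * e n - M.
have hU n w : u w < U n w <= u w + e n.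
  by have /andP[] := grid_itv w (e0 n) uM; rewrite /U => ? ?; apply/andP; split; lra.
have hV n w : v w - e n <= V n w <= v w.
  by have /andP[] := grid_itv w (e0 n) vM; rewrite /V => ? ?; apply/andP; split; lra.
have UM n w : `|U n w| <= M + 1.
  have := uM w; rewrite !ler_norml => /andP[? ?]; have := e1 n.
  by have /andP[? ?] := hU n w => ?; apply/andP; split; lra.
have VM n w : `|V n w| <= M + 1.
  have := vM w; rewrite !ler_norml => /andP[? ?]; have := e1 n.
  by have /andP[? ?] := hV n w => ?; apply/andP; split; lra.
have LU n : LinfF (U n).
  split; first by exists (M + 1).
  apply: (@G_measurable_countable _ _ _ sF _ (grid u M (e n)) (fun k => k%:R * e n - M + e n)).
  by move=> k; exact: grid_measurable.
have LV n : LinfF (V n).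
  split; first by exists (M + 1).
  apply: (@G_measurable_countable _ _ _ sF _ (grid v M (e n)) (fun k => k%:R * e n - M)).
  by move=> k; exact: grid_measurable.
(* The upper approximations of [u] and the lower ones of [v] are comparable for
   independent mesh sizes, so the two limits can be taken one after the other. *)
have UV n m : pref (U n) (V m).
  (* The pair of cell indices is coded as one number, as [pref_step] requires. The default 0 in [a]
     and [b] is never attained along [c]. *)
  pose c w := pickle (grid u M (e n) w, grid v M (e m) w).
  pose a k := if unpickle k is Some (i, j) then
    (fun _ : nat => i%:R * e n - M + e n) (j : nat) else 0.
  pose b k := if unpickle k is Some (i, j) then
    (fun _ : nat => j%:R * e m - M) (i : nat) else 0.
  have -> : U n = a \o c by apply/funext => w; rewrite /= /a /c pickleK.
  have -> : V m = b \o c by apply/funext => w; rewrite /= /b /c pickleK.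
  apply: (@pref_step _ _ _ (M + 1)) => [k|w|w|w].
  - have [[[i j] ij]|nk] := pselect (exists ij : nat * nat, pickle ij = k); last first.
      have -> : c @^-1` [set k] = set0; last exact: measurable0.
      by apply/seteqP; split => w //= cw; apply: nk; eexists; exact: cw.
    have -> : c @^-1` [set k] =
        grid u M (e n) @^-1` [set i] `&` grid v M (e m) @^-1` [set j].
      apply/seteqP; split => w /=; rewrite /c -ij.
        by move=> /(pcan_inj pickleK)[-> ->].
      by move=> [-> ->].
    by apply: measurableI; exact: grid_measurable.
  - rewrite /a /b /c pickleK -/(U n w) -/(V m w).
    have /andP[? ?] := hU n w; have /andP[? ?] := hV m w; have := vu w; lra.
  - by rewrite /a /c pickleK -/(U n w).
  - by rewrite /b /c pickleK -/(V m w).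
apply: (@pref_lim_r V) => //; first by exists (M + 1).
  move=> w; apply: cvg_dist_harmonic => n; have /andP[? ?] := hV n w.
  by rewrite ler_norml -/(e n); have := e0 n => ?; apply/andP; split; lra.
move=> m; apply: (@pref_lim_l U) => //; first by exists (M + 1).
move=> w; apply: cvg_dist_harmonic => n; have /andP[? ?] := hU n w.
by rewrite ler_norml -/(e n); have := e0 n => ?; apply/andP; split; lra.
Qed.

(** * Certainty equivalents and representing functionals *)

Lemma null_eventT_indiff f g : null_event pref setT -> LinfF f -> LinfF g -> pref f g.
Proof.
move=> [_ nT] Lf Lg; have [+ _] := nT f g Lf Lg.
by have -> : mix setT f g = f by mix_cases.
Qed.

Lemma pref_cst (x y : R) : ~ null_event pref setT ->
  pref (cst x) (cst y) <-> y <= x.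
Proof.
move=> nT; split=> [xy|yx]; last exact: pref_mono.
rewrite leNgt; apply/negP => /(sm (@measurableT _ Omega) nT (LinfF_cst 0))[_].
have mixT z : mix setT (cst z) (cst 0) = cst z :> (Omega -> R) by mix_cases.
by rewrite !mixT; apply.
Qed.

(** The equivalent is the supremum of the constants that [f] is preferred to. Constants below it are
    dominated by members of that set and constants above it are not members, so both preferences
    follow in the limit. *)
Lemma certainty_equivalent f : ~ null_event pref setT -> LinfF f ->
  exists x : R, indiff pref f (cst x).
Proof.
move=> nT Lf; have [[M fM] _] := Lf.
pose S := [set x : R | pref f (cst x)].
have S0 : S (- M).
  by apply: pref_mono => // w /=; have := fM w; rewrite ler_norml => /andP[].
have SM x : S x -> x <= M.
  move=> fx; rewrite -(pref_cst _ _ nT); apply: pref_trans fx => //.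
  by apply: pref_mono => // w /=; have := fM w; rewrite ler_norml => /andP[].
(* The factor [s] is -1 for the approach from below and 1 for the approach from above. *)
have bd (s : R) : `|s| <= 1 -> exists N : R, forall n (w : Omega),
    `|cst (sup S + s * n.+1%:R^-1) w| <= N.
  move=> s1; exists (`|sup S| + 1) => n w /=; rewrite (le_trans (ler_normD _ _))// lerD2l.
  rewrite normrM (ger0_norm (_ : 0 <= n.+1%:R^-1)) ?invr_ge0//.
  by rewrite mulr_ile1// ?invr_ge0// invf_le1// ler1n.
have cv (s : R) : `|s| <= 1 -> forall w : Omega,
    (fun n => cst (sup S + s * n.+1%:R^-1) w) @ \oo --> cst (sup S) w.
  move=> s1 w /=; apply: cvg_dist_harmonic => n.
  rewrite addrC addKr normrM (ger0_norm (_ : 0 <= n.+1%:R^-1)) ?invr_ge0//.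
  by rewrite ler_piMl ?invr_ge0.
have hS : has_sup S by split; [exists (- M)|exists M].
exists (sup S); split.
  apply: (@pref_lim_r (fun n => cst (sup S + -1 * n.+1%:R^-1))) => //.
  - by apply: bd; rewrite normrN normr1.
  - by apply: cv; rewrite normrN normr1.
  - move=> n; have [|y Sy yS] := @sup_adherent R S n.+1%:R^-1 _ hS.
      by rewrite invr_gt0.
    apply: pref_trans Sy _ => //; apply: pref_mono => // w /=.
    by rewrite mulN1r ltW.
apply: (@pref_lim_l (fun n => cst (sup S + 1 * n.+1%:R^-1))) => //.
- by apply: bd; rewrite normr1.
- by apply: cv; rewrite normr1.
- move=> n; case: (@pref_total f (cst (sup S + 1 * n.+1%:R^-1))) => //.
  move=> /(sup_upper_bound hS); rewrite mul1r.
  by rewrite -subr_ge0 opprD addrA subrr add0r oppr_ge0 invr_le0 lern0.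
Qed.

Lemma representation_exists : ~ null_event pref setT ->
  exists T : (Omega -> R) -> R, represents pref T.
Proof.
move=> nT.
have /choice[T TP] f : exists x : R, LinfF f -> indiff pref f (cst x).
  have [Lf|nLf] := pselect (LinfF f); last by exists 0.
  by have [x fx] := certainty_equivalent nT Lf; exists x.
exists T => f g Lf Lg; have [f1 f2] := TP f Lf; have [g1 g2] := TP g Lg.
rewrite -pref_cst//; split => h.
  by apply: (pref_trans _ _ _ f1) => //; apply: (pref_trans _ _ _ h g2).
by apply: (pref_trans _ _ _ f2) => //; apply: (pref_trans _ _ _ h g1).
Qed.

Lemma represents_eq T f g : represents pref T -> LinfF f -> LinfF g ->
  T f = T g <-> indiff pref f g.
Proof.
move=> rT Lf Lg; split=> [fg|[/rT h1 /rT h2]].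
  by split; apply/rT; rewrite ?fg.
by apply/le_anti; rewrite h1 ?h2.
Qed.

(** * From conditionability to (ST) *)

Lemma indiff_sym f g : indiff pref f g -> indiff pref g f.
Proof. by case. Qed.

Lemma indiff_trans g f h : LinfF f -> LinfF g -> LinfF h ->
  indiff pref f g -> indiff pref g h -> indiff pref f h.
Proof.
move=> Lf Lg Lh [fg gf] [gh hg].
by split; [exact: (pref_trans _ _ _ fg gh)|exact: (pref_trans _ _ _ hg gf)].
Qed.

Lemma pref_indiff f g f' g' : LinfF f -> LinfF g -> LinfF f' -> LinfF g' ->
  indiff pref f f' -> indiff pref g g' -> pref f g -> pref f' g'.
Proof.
move=> Lf Lg Lf' Lg' [_ ff] [gg _] fg.
by apply: (pref_trans _ _ _ ff) => //; exact: (pref_trans _ _ _ fg gg).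
Qed.

Lemma pref_mix_cstP A h (x y : R) : measurable A -> ~ null_event pref A -> LinfF h ->
  pref (mix A (cst x) h) (mix A (cst y) h) <-> y <= x.
Proof.
move=> mA nA Lh; split=> [xy|]; last exact: pref_mix_cst.
by rewrite leNgt; apply/negP => /(sm mA nA Lh)[_]; apply.
Qed.

Lemma indiff_mix_cst A h (x y : R) : measurable A -> ~ null_event pref A -> LinfF h ->
  indiff pref (mix A (cst x) h) (mix A (cst y) h) -> x = y.
Proof.
by move=> mA nA Lh [/pref_mix_cstP yx /pref_mix_cstP xy]; apply/le_anti; rewrite xy ?yx.
Qed.

(** A conditional equivalent of [mix A u k] is constant on [A] and on its complement. Testing it on
    [A], on the complement and on the whole space gives the three indifferences; an empty piece gets
    the constant 0. *)
Lemma conditionable_sigma_of_mix T A u k : represents pref T -> measurable A ->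
  conditionable T (sigma_of A) -> LinfF u -> LinfF k ->
  exists a b : R, [/\ indiff pref (mix A u (cst 0)) (mix A (cst a) (cst 0)),
    indiff pref (mix (~` A) k (cst 0)) (mix (~` A) (cst b) (cst 0)) &
    indiff pref (mix A u k) (mix A (cst a) (cst b))].
Proof.
move=> rT mA cT Lu Lk; have mA' := measurableC mA.
have [g [Lg gP]] := cT _ (LinfF_mix mA Lu Lk).
have [a ga] : exists a : R, forall w, A w -> g w = a.
  have [[w Aw]|nA] := pselect (exists w, A w); last by exists 0 => w Aw; case: nA; exists w.
  by exists (g w) => w' Aw'; exact: (sigma_of_const Lg).
have [b gb] : exists b : R, forall w, ~ A w -> g w = b.
  have [[w Aw]|nA] := pselect (exists w, ~ A w); last by exists 0 => w Aw; case: nA; exists w.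
  by exists (g w) => w' Aw'; apply: (sigma_of_const Lg); tauto.
have gE : g = mix A (cst a) (cst b).
  by rewrite mixE; apply/funext => w; case: asboolP => [/ga|/gb].
exists a, b; split; apply/(represents_eq rT); auto.
- have := gP A; rewrite gE !restr_mix.
  have mixA p q : mix A (mix A p q) (cst 0) = mix A p (cst 0) by mix_cases.
  by rewrite !mixA; apply; left; right.
- have := gP (~` A); rewrite gE !restr_mix.
  have mixA p q : mix (~` A) (mix A p q) (cst 0) = mix (~` A) q (cst 0) by mix_cases.
  by rewrite !mixA; apply; right.
- have := gP setT; rewrite gE !restr_mix.
  have mixA p : mix setT p (cst 0) = p by mix_cases.
  by rewrite !mixA; apply; left; left; right.
Qed.

Lemma ST_of_conditionable :
  (forall T, represents pref T -> forall A, measurable A -> conditionable T (sigma_of A)) ->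
  ST pref.
Proof.
move=> cT f g h A Lf Lg Lh mA fg h' Lh'; have mA' := measurableC mA.
(* Null events are settled first: below, a functional must exist and the constants must be unique on
   both [A] and its complement. *)
have [nT|nT] := pselect (null_event pref setT); first by apply: null_eventT_indiff; auto.
have [[_ nA]|nA] := pselect (null_event pref A).
  have [fh _] := nA f h' Lf Lh'; have [_ hg] := nA g h' Lg Lh'.
  by apply: (pref_trans _ _ _ fh hg); auto.
have [[_ nA']|nA'] := pselect (null_event pref (~` A)).
  have swap p : LinfF p -> indiff pref (mix A p h) (mix A p h').
    move=> Lp; have := nA' _ _ Lh (LinfF_mix mA Lp Lh').
    by have -> : mix (~` A) h (mix A p h') = mix A p h by mix_cases.
  by apply: (pref_indiff _ _ _ _ (swap f Lf) (swap g Lg) fg); auto.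
have [T rT] := representation_exists nT.
have cond := conditionable_sigma_of_mix rT mA (cT T rT A mA).
have [a [b [fa hb fh]]] := cond _ _ Lf Lh.
have [a2 [b2 [ga hb2 gh]]] := cond _ _ Lg Lh.
have [a3 [b3 [fa3 hb3 fh']]] := cond _ _ Lf Lh'.
have [a4 [b4 [ga4 hb4 gh']]] := cond _ _ Lg Lh'.
have uniq B p (x y : R) : measurable B -> ~ null_event pref B -> LinfF p ->
    indiff pref (mix B p (cst 0)) (mix B (cst x) (cst 0)) ->
    indiff pref (mix B p (cst 0)) (mix B (cst y) (cst 0)) -> x = y.
  move=> mB nB Lp /indiff_sym px py; apply: (indiff_mix_cst mB nB (LinfF_cst 0)).
  by apply: (indiff_trans _ _ _ px py); auto.
have eb : b = b2 by exact: (uniq _ _ _ _ mA' nA' Lh).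
have eb' : b3 = b4 by exact: (uniq _ _ _ _ mA' nA' Lh').
have ea : a = a3 by exact: (uniq _ _ _ _ mA nA Lf).
have ea' : a2 = a4 by exact: (uniq _ _ _ _ mA nA Lg).
subst b2 b4 a3 a4.
(* Only the constants on [A] now distinguish [f] from [g], and their order does not depend on the
   common constant on the complement. *)
have a2a : a2 <= a.
  apply/(pref_mix_cstP _ _ mA nA (LinfF_cst b)).
  by apply: (pref_indiff _ _ _ _ fh gh fg); auto.
apply: (pref_indiff _ _ _ _ (indiff_sym fh') (indiff_sym gh')); auto.
exact: pref_mix_cst.
Qed.

(** * Conditional preference on an event *)

(** Quantifying over every continuation [h] makes transitivity and additivity in [A] available
    before (ST) is assumed. *)
Definition cpref A u v : Prop :=
  forall h, LinfF h -> pref (mix A u h) (mix A v h).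

Lemma cpref_trans A v u u' : measurable A -> LinfF u -> LinfF v -> LinfF u' ->
  cpref A u v -> cpref A v u' -> cpref A u u'.
Proof.
move=> mA Lu Lv Lu' uv vu h Lh.
by apply: (pref_trans _ _ _ (uv h Lh) (vu h Lh)); auto.
Qed.

Lemma cpref_mono A u v : measurable A -> LinfF u -> LinfF v ->
  (forall w, A w -> v w <= u w) -> cpref A u v.
Proof.
move=> mA Lu Lv vu h Lh; apply: pref_mono; auto => w.
by rewrite !mixE; case: asboolP => // /vu.
Qed.

Lemma cpref_null A u v : null_event pref A -> LinfF u -> LinfF v -> cpref A u v.
Proof.
move=> [mA nA] Lu Lv h Lh; have [uh _] := nA u h Lu Lh; have [_ hv] := nA v h Lv Lh.
by apply: (pref_trans _ _ _ uh hv); auto.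
Qed.

(** Replace [u] by [v] on [A] while [B] still carries [u], then on [B] while [A] carries [v]; each
    time the other event belongs to the continuation. *)
Lemma cprefU A B u v : measurable A -> measurable B -> A `&` B = set0 ->
  LinfF u -> LinfF v -> cpref A u v -> cpref B u v -> cpref (A `|` B) u v.
Proof.
move=> mA mB AB0 Lu Lv uvA uvB h Lh.
have AB w : A w -> B w -> False by move=> Aw Bw; rewrite -[False]/(set0 w) -AB0.
have -> : mix (A `|` B) u h = mix A u (mix B u h) by mix_cases.
have -> : mix (A `|` B) v h = mix B v (mix A v h) by mix_cases.
apply: (pref_trans _ _ _ (uvA (mix B u h) _)); auto.
have -> : mix A v (mix B u h) = mix B u (mix A v h).
  by rewrite !mixE; apply/funext => w; do 2 case: asboolP => //; move=> ? ?; exfalso; exact: (AB w).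
by apply: uvB; auto.
Qed.

Lemma cpref_bigcup (E : nat -> set Omega) u v :
  (forall n, measurable (E n)) -> trivIset setT E -> LinfF u -> LinfF v ->
  (forall n, cpref (E n) u v) -> cpref (\bigcup_n E n) u v.
Proof.
move=> mE tE Lu Lv uv h Lh.
have mU : measurable (\bigcup_n E n) by exact: bigcupT_measurable.
(* [k n] carries [v] on the first [n] sets, [u] on the rest of the union and [h] outside it. *)
pose k := fix k n := if n is n'.+1 then mix (E n') v (k n') else mix (\bigcup_n E n) u h.
have Lk n : LinfF (k n) by elim: n => [|n ih] /=; auto.
have k_out n w : (forall i, (i < n)%N -> ~ E i w) -> k n w = k 0 w.
  elim: n => // n ih nE; rewrite [k n.+1]/= mixE; case: asboolP => [|_]; first by move/(nE n (ltnSn n)).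
  by apply: ih => i ?; apply: nE; exact: ltnW.
have k_in n i w : (i < n)%N -> E i w -> k n w = v w.
  elim: n => // n ih; rewrite ltnS leq_eqVlt [k n.+1]/= mixE => /predU1P[-> Ew|ni Ew].
    by case: asboolP.
  by case: asboolP => // _; exact: ih.
have [[Mu uM] _] := Lk 0; have [[Mv vM] _] := Lv.
apply: (@pref_lim_r k) => //; auto.
- exists (Num.max Mu Mv); elim=> [|n ih] w; first by rewrite le_max uM.
  by rewrite [k n.+1]/= mixE le_max; case: asboolP => _; rewrite ?vM ?orbT// -le_max.
- move=> w; rewrite mixE; case: asboolP => [[i _ Ei]|nE].
    by apply: (@cvg_eventually_eq _ _ _ i.+1) => n ni; exact: (k_in _ i).
  apply: (@cvg_eventually_eq _ _ _ 0) => n _; rewrite k_out ?[k 0]/= ?mixE.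
    by case: asboolP.
  by move=> i _ Ei; apply: nE; exists i.
- elim=> [|n ih]; first by apply: pref_refl; auto.
  apply: (pref_trans _ _ _ ih); auto.
  (* By disjointness the earlier replacements leave [u] untouched on [E n]. *)
  suff {1}-> : k n = mix (E n) u (k n) by apply: uv; auto.
  rewrite mixE; apply/funext => w; case: asboolP => // En.
  rewrite k_out ?[k 0]/= ?mixE.
    by case: asboolP => // nE; exfalso; apply: nE; exists n.
  move=> i ni Ei; have /trivIsetP/(_ i n I I) := tE.
  rewrite (ltn_eqF ni) => /(_ isT) => ein; rewrite -[False]/(set0 w) -ein.
  by split.
Qed.

Lemma LinfF_addr u (e : R) : LinfF u -> LinfF (fun w => u w + e).
Proof.
move=> [[M uM] mu]; split; last exact: G_measurable_addr.
by exists (M + `|e|) => w; rewrite (le_trans (ler_normD _ _))// lerD2r.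
Qed.

Hint Resolve LinfF_addr : core.

Lemma mix_addr_cvg A u h (e : nat -> R) : (forall n, `|e n| <= n.+1%:R^-1) ->
  LinfF u -> LinfF h ->
  (exists M, forall n w, `|mix A (fun w => u w + e n) h w| <= M) /\
  (forall w, (fun n => mix A (fun w => u w + e n) h w) @ \oo --> mix A u h w).
Proof.
move=> eh [[M uM] _] [[N hN] _]; split.
  exists (Num.max (M + 1) N) => n w; rewrite mixE le_max.
  case: asboolP => _; rewrite ?hN ?orbT// (le_trans (ler_normD _ _))// lerD//.
  by rewrite (le_trans (eh n))// invf_le1// ler1n.
move=> w; apply: cvg_dist_harmonic => n; rewrite !mixE.
by case: asboolP => _; rewrite ?(addrAC _ (e n)) subrr ?add0r ?normr0 ?invr_ge0.
Qed.

Lemma cpref_lim_l A u v : measurable A -> LinfF u -> LinfF v ->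
  (forall e, 0 < e -> cpref A (fun w => u w + e) v) -> cpref A u v.
Proof.
move=> mA Lu Lv uv h Lh.
have [|bd cv] := @mix_addr_cvg A u h (fun n => n.+1%:R^-1) _ Lu Lh.
  by move=> n; rewrite ger0_norm ?invr_ge0.
apply: (@pref_lim_l _ _ _ _ _ _ bd cv); auto.
by move=> n; apply: uv => //; rewrite invr_gt0.
Qed.

Lemma cpref_lim_r A u v : measurable A -> LinfF u -> LinfF v ->
  (forall e, 0 < e -> cpref A u (fun w => v w - e)) -> cpref A u v.
Proof.
move=> mA Lu Lv uv h Lh.
have [|bd cv] := @mix_addr_cvg A v h (fun n => - n.+1%:R^-1) _ Lv Lh.
  by move=> n; rewrite normrN ger0_norm ?invr_ge0.
apply: (@pref_lim_r _ _ _ _ _ _ bd cv); auto.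
by move=> n; apply: uv => //; rewrite invr_gt0.
Qed.

(* Greedy exhaustion: [B n] is chosen among the members of [K] avoiding the
   previous sets so that its indicator dominates a constant [1/(j+1)] with [j]
   least possible. Indicators of disjoint sets tend to [0], hence so do these
   constants, and nothing non-null is left over. *)
Lemma exhaustion (K : set (set Omega)) : K `<=` measurable ->
  exists B : nat -> set Omega, [/\ forall n, K (B n) \/ B n = set0,
    trivIset setT B &
    forall C, K C -> (forall n, C `&` B n = set0) -> null_event pref C].
Proof.
move=> mK.
pose big C (j : nat) := pref (mix C (cst 1) (cst 0)) (cst j.+1%:R^-1).
have step X : exists C, [/\ K C \/ C = set0, C `<=` X &
    forall C' j, K C' -> C' `<=` X -> big C' j -> big C j].
  (* If no member of [K] inside [X] reaches any level, the empty set is chosen and maximality is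
     vacuous. *)
  have [ex|nex] := pselect (exists j, `[< exists C, [/\ K C, C `<=` X & big C j] >]); last first.
    exists set0; split; [by right|exact: sub0set|].
    by move=> C j KC CX bC; exfalso; apply: nex; exists j; apply/asboolP; exists C.
  case: (ex_minnP ex) => j /asboolP[C [KC CX bC]] jmin.
  exists C; split; [by left|by []|] => C' i KC' CX' bC'.
  have ji : (j <= i)%N by apply: jmin; apply/asboolP; exists C'.
  apply: (pref_trans _ _ _ bC); [by apply: LinfF_mix; [exact: mK| |]|by []|by []|].
  by apply: pref_mono => // w /=; rewrite lef_pV2 ?posrE// ler_nat.
have [pickC pickP] := choice step.
pose X n := iter n (fun X => X `\` pickC X) setT.
pose B n := pickC (X n).
have BX n : B n `<=` X n by case: (pickP (X n)).
have KB n : K (B n) \/ B n = set0 by case: (pickP (X n)).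
have mB n : measurable (B n) by case: (KB n) => [/mK//|->].
have XB m n : (m < n)%N -> X n `<=` ~` B m.
  elim: n => // n ih; rewrite ltnS leq_eqVlt => /predU1P[->|/ih XB] w [].
    by [].
  by move=> /XB.
have disj m n w : B m w -> B n w -> m = n.
  by case: (ltngtP m n) => // mn Bm Bn; [case: (XB m n mn w)|case: (XB n m mn w)] => //; exact: BX.
exists B; split=> //.
  by apply/trivIsetP => i j _ _ /eqP ij; apply/seteqP; split => // w [Bi Bj]; apply/ij/disj; eassumption.
move=> C KC CB; apply: contrapT => nC; have mC := mK _ KC.
have nT : ~ null_event pref setT.
  move=> nT; apply: nC; split=> // f g Lf Lg.
  by split; apply: null_eventT_indiff; auto.
have CX n : C `<=` X n.
  elim: n => // n ih w Cw; split; first exact: ih.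
  by move=> Bw; rewrite -[False]/(set0 w) -(CB n).
(* By (SM) the indicator of the non-null [C] is strictly above 0, hence by (PC) above some constant
   of the vanishing sequence. *)
have [j bC] : exists j, big C j.
  have := sm mC nC (LinfF_cst 0) (@ltr01 R).
  have -> : mix C (cst 0) (cst 0) = cst 0 :> (Omega -> R) by mix_cases.
  move=> C0.
  have bd : exists M : R, forall n (w : Omega), `|cst (n.+1%:R^-1) w| <= M.
    by exists 1 => n w /=; rewrite ger0_norm ?invr_ge0// invf_le1// ler1n.
  have cv : forall w : Omega, (fun n => cst (n.+1%:R^-1 : R) w) @ \oo --> cst (0 : R) w.
    by move=> w; exact: cvg_harmonic.
  have [/(_ C0)[N /(_ N.+1 (ltnSn _))[CN _]] _] := pc (fun n => LinfF_cst _) (LinfF_cst 0)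
    bd cv (LinfF_mix mC (LinfF_cst 1) (LinfF_cst 0)).
  by exists N.+1.
(* [C] was available at every stage, so every chosen set reaches level [j] too. *)
have bB n : big (B n) j by case: (pickP (X n)) => _ _; apply; [exact: KC|exact: CX|exact: bC].
have : pref (cst 0) (cst j.+1%:R^-1).
  apply: (@pref_lim_l (fun n => mix (B n) (cst 1) (cst 0))); auto.
  - exists 1 => n w; rewrite mixE; case: asboolP => _ /=; rewrite ?normr0 ?normr1//.
  - move=> w; have [[m Bm]|nB] := pselect (exists m, B m w).
      apply: (@cvg_eventually_eq _ _ _ m.+1) => n mn; rewrite mixE; case: asboolP => // Bn.
      by move: mn; rewrite (disj _ _ _ Bm Bn) ltnn.
    apply: (@cvg_eventually_eq _ _ _ 0) => n _; rewrite mixE; case: asboolP => // Bn.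
    by exfalso; apply: nB; exists n.
by rewrite pref_cst// leNgt invr_gt0 ltr0n.
Qed.

Section separability.
Hypothesis st : ST pref.

(** This is where (ST) enters: one continuation decides for all, which makes [cpref] complete. *)
Lemma cprefP A u v h : measurable A -> LinfF u -> LinfF v -> LinfF h ->
  pref (mix A u h) (mix A v h) -> cpref A u v.
Proof. move=> mA Lu Lv Lh uv h' Lh'; exact: st uv h' Lh'. Qed.

Lemma cpref_total A u v : measurable A -> LinfF u -> LinfF v ->
  cpref A u v \/ cpref A v u.
Proof.
move=> mA Lu Lv; have L0 := LinfF_cst 0.
by case: (pref_total (LinfF_mix mA Lu L0) (LinfF_mix mA Lv L0)) => /cprefP h;
  [left|right]; exact: h.
Qed.

(** * Hahn decomposition for conditional preference *)

Section hahn.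
Variable G : set (set Omega).
Hypothesis subG : is_sub_sigma_algebra G.

Let sG : sigma_algebra setT G. Proof. by case: subG. Qed.
Let mG : G `<=` measurable. Proof. by case: subG. Qed.

(** Remove from [A] an exhausting family of sets on which [v] is not preferred to [u]. By
    completeness [u] is preferred on those, so its failure on [A] persists on the remainder, where
    any further such set would be null. *)
Lemma hahn_subset A u v : LinfF u -> LinfF v -> G A -> ~ cpref A u v ->
  exists P, [/\ G P, P `<=` A, ~ cpref P u v & forall C, G C -> C `<=` P -> cpref C v u].
Proof.
move=> Lu Lv GA nA.
have [B [KB tB exB]] := @exhaustion [set B | [/\ G B, B `<=` A & ~ cpref B v u]]
  (fun B '(And3 GB _ _) => mG GB).
have GB n : G (B n) by case: (KB n) => [[]//|->]; exact: sigma_set0.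
have BA n : B n `<=` A by case: (KB n) => [[]//|->]; exact: sub0set.
have GU : G (\bigcup_n B n) by exact: sigma_bigcup.
exists (A `\` \bigcup_n B n); split.
- exact: sigma_setD.
- by move=> w [].
- move=> uvP; apply: nA.
  have -> : A = (A `\` \bigcup_n B n) `|` \bigcup_n B n.
    by rewrite setUC setDUK// => w [n _ /BA].
  apply: cprefU => //; [by apply: mG; exact: sigma_setD|exact: mG|by apply/seteqP; split=> // w [[]]|].
  apply: cpref_bigcup => // n; first exact: mG.
  case: (KB n) => [[_ _ nvu]|->]; last by apply: cpref_mono.
  by case: (cpref_total (mG (GB n)) Lu Lv).
- move=> C GC CP; apply: contrapT => nC; apply: (nC); apply: cpref_null => //.
  apply: exB; first by split=> // w /CP[].
  by move=> n; apply/seteqP; split=> // w [/CP[_ nB] Bw]; apply: nB; exists n.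
Qed.

(** Exhaust the space by the sets that [hahn_subset] produces. A bad subset of the complement would
    contain another one, necessarily null, yet on null events every preference holds. *)
Lemma hahn_decomposition u v : LinfF u -> LinfF v -> exists A,
  [/\ G A, forall B, G B -> B `<=` A -> cpref B u v &
           forall B, G B -> B `<=` ~` A -> cpref B v u].
Proof.
move=> Lu Lv.
have [B [KB tB exB]] := @exhaustion
  [set P | [/\ G P, ~ cpref P u v & forall C, G C -> C `<=` P -> cpref C v u]]
  (fun B '(And3 GB _ _) => mG GB).
have GB n : G (B n) by case: (KB n) => [[]//|->]; exact: sigma_set0.
have GU : G (\bigcup_n B n) by exact: sigma_bigcup.
exists (~` \bigcup_n B n); split; first exact: sigma_setC.
  move=> C GC CU; apply: contrapT => /(hahn_subset Lu Lv GC)[P [GP PC nP vuP]].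
  apply: (nP); apply: cpref_null => //; apply: exB => //.
  by move=> n; apply/seteqP; split=> // w [/PC/CU nB Bw]; apply: nB; exists n.
rewrite setCK => C GC CU.
have -> : C = \bigcup_n (C `&` B n) by rewrite -setI_bigcupr; apply/esym/setIidl.
apply: cpref_bigcup => //.
- by move=> n; apply: mG; exact: sigma_setI.
- exact: trivIset_setIl.
- move=> n; case: (KB n) => [[_ _ h]|->]; last by rewrite setI0; exact: cpref_mono.
  by apply: h; [exact: sigma_setI|exact: subIsetr].
Qed.

(** * Conditional certainty equivalents *)

Section conditional_certainty_equivalent.
Variables (f : Omega -> R) (M : R).
Hypotheses (Lf : LinfF f) (fM : forall w, `|f w| <= M).

Let f_le w : f w <= M. Proof. by have := fM w; rewrite ler_norml => /andP[]. Qed.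
Let f_ge w : - M <= f w. Proof. by have := fM w; rewrite ler_norml => /andP[]. Qed.

(** Beyond the bound [M] monotonicity allows the trivial choices of [A q]; they make the supremum
    defining [g] run over a nonempty bounded set. *)
Lemma upper_level_sets : exists A : rat -> set Omega, forall q,
  [/\ G (A q), forall B, G B -> B `<=` A q -> cpref B f (cst (ratr q)),
      forall B, G B -> B `<=` ~` A q -> cpref B (cst (ratr q)) f,
      M < ratr q -> A q = set0 & ratr q < - M -> A q = setT].
Proof.
suff /choice[A AP] : forall q : rat, exists A, [/\ G A,
    forall B, G B -> B `<=` A -> cpref B f (cst (ratr q)),
    forall B, G B -> B `<=` ~` A -> cpref B (cst (ratr q)) f,
    M < ratr q -> A = set0 & ratr q < - M -> A = setT] by exists A.
move=> q; have [Mq|qM] := ltP M (ratr q).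
  exists set0; split => //; first exact: sigma_set0.
  - by move=> B GB B0; apply: cpref_mono => //; [exact: mG|move=> w /B0].
  - move=> B GB _; apply: cpref_mono => //; first exact: mG.
    by move=> w _ /=; exact/(le_trans (f_le w))/ltW.
  - move=> qM; apply/seteqP; split=> // w _.
    by have := f_le w; have := f_ge w; lra.
have [qM'|Mq] := ltP (ratr q) (- M); last first.
  have [A [GA pos neg]] := hahn_decomposition Lf (LinfF_cst (ratr q)).
  by exists A; split.
exists setT; split => //; first exact: sigma_setT.
- move=> B GB _; apply: cpref_mono => //; first exact: mG.
  by move=> w _ /=; apply: le_trans (f_ge w); exact: ltW.
- by move=> B GB B0; apply: cpref_mono => //; [exact: mG|rewrite setCT in B0 => w /B0].
Qed.

Lemma conditional_equivalent_bounds : exists g : Omega -> R, [/\ Linf G g,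
  forall B s, G B -> (forall w, B w -> s <= g w) -> cpref B f (cst s) &
  forall B t, G B -> (forall w, B w -> g w <= t) -> cpref B (cst t) f].
Proof.
have [A AP] := upper_level_sets.
pose S w := [set ratr q | q in [set q | A q w]] : set R.
pose g w := sup (S w).
have S0 w : S w !=set0.
  have [q] := @rat_in_itvoo R (- M - 1) (- M) ltac:(lra).
  rewrite in_itv/= => /andP[_ qM]; exists (ratr q); exists q => //=.
  by case: (AP q) => _ _ _ _ ->.
have SM w x : S w x -> x <= M.
  move=> [q Aq <-]; rewrite leNgt; apply/negP => Mq.
  by case: (AP q) => _ _ _ /(_ Mq) Aq0 _; rewrite /= Aq0 in Aq.
have hS w : has_sup (S w) by split=> //; exists M => x; exact: SM.
have gtP w t : t < g w <-> exists q, t < ratr q /\ A q w.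
  split=> [/(sup_gt (S0 w))[_ [q Aq <-] tq]|[q [tq Aq]]]; first by exists q.
  by apply: lt_le_trans tq _; apply: sup_upper_bound => //; exists q.
(* An enumeration of the sets [A q] with [q] above [t]; their union is the set where [g] exceeds
   [t]. *)
pose F t n := if unpickle n is Some q then
  (if t < ratr q :> R then A q else set0) else set0.
have GF t n : G (F t n).
  rewrite /F; case: unpickle => [q|]; last exact: sigma_set0.
  by case: ifP => _; [case: (AP q)|exact: sigma_set0].
have gtF t : [set w | t < g w] = \bigcup_n F t n.
  apply/seteqP; split=> w /=.
    by move=> /gtP[q [tq Aq]]; exists (pickle q); [exact: I|rewrite /F pickleK tq].
  move=> [n _]; rewrite /F; case: unpickle => // q; case: ifP => // tq Aq.
  by apply/gtP; exists q.
exists g; split.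
- split.
    exists M => w; rewrite ler_norml; apply/andP; split; last exact: (ge_sup (S0 w) (SM w)).
    rewrite leNgt; apply/negP => /rat_in_itvoo[q]; rewrite in_itv/= => /andP[gq qM].
    have : g w < g w; last by rewrite ltxx.
    by apply/gtP; exists q; split=> //; case: (AP q) => _ _ _ _ ->.
  by apply: G_measurable_gt => // t; rewrite gtF; exact: sigma_bigcup.
- move=> B s GB sg; apply: cpref_lim_r => // [|e e0]; first exact: mG.
  (* [B] is cut into disjoint pieces, each empty or inside one [A q] with [q] above [s - e]. *)
  pose D := seqDU (fun n => B `&` F (s - e) n).
  have -> : B = \bigcup_n D n.
    rewrite -seqDU_bigcup_eq -setI_bigcupr -gtF; apply/esym/setIidl => w /sg /=.
    by apply: lt_le_trans; rewrite gtrBl.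
  have GD n : G (D n).
    apply: sigma_setD => //; first exact: sigma_setI.
    by apply: big_ind => [|? ? ? ?|i _]; [exact: sigma_set0|exact: sigma_setU|exact: sigma_setI].
  apply: cpref_bigcup (trivIset_seqDU _) _ _ _; auto => n.
  have : D n `<=` F (s - e) n by apply: (subset_trans (@subset_seqDU _ _ n)); exact: subIsetr.
  rewrite /F; case: unpickle => [q|]; [case: ifP => [tq|_]|] => DF.
  - have [_ pos _ _ _] := AP q; apply: (cpref_trans _ _ _ _ (pos _ (GD n) DF)); auto.
    by apply: cpref_mono; auto => w _ /=; exact: ltW.
  - by apply: cpref_mono; auto => w /DF.
  - by apply: cpref_mono; auto => w /DF.
- move=> B t GB gt; apply: cpref_lim_l => // [|e e0]; first exact: mG.
  (* Points of [A q] have [g] at least [q], which exceeds [t], so [B] misses [A q]. *)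
  have [q] := @rat_in_itvoo R t (t + e) ltac:(lra).
  rewrite in_itv/= => /andP[tq qe]; have [_ _ neg _ _] := AP q.
  have mB := mG GB; have Lte : LinfF (fun w : Omega => cst t w + e) by exact: LinfF_addr.
  apply: (@cpref_trans _ (cst (ratr q))) => //.
    by apply: cpref_mono => // w _ /=; exact: ltW.
  apply: neg => // w Bw Aq; have : g w < g w; last by rewrite ltxx.
  by apply: le_lt_trans (gt _ Bw) _; apply/gtP; exists q.
Qed.

Lemma conditional_equivalent : exists2 g : Omega -> R, Linf G g &
  forall A, G A -> cpref A f g /\ cpref A g f.
Proof.
have [g [Lg lower upper]] := conditional_equivalent_bounds.
exists g => // A GA; have [[N gN] mg] := Lg.
have LFg : LinfF g by split; [exists N|move=> B mB; exact/mG/mg].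
pose cell e k := A `&` grid g N e @^-1` [set k].
have Gcell e k : 0 < e -> G (cell e k).
  by move=> e0; apply: sigma_setI => //; exact: grid_measurable.
have cells u v e : LinfF u -> LinfF v -> 0 < e ->
    (forall k, cpref (cell e k) u v) -> cpref A u v.
  move=> Lu Lv e0 uv; have -> : A = \bigcup_k cell e k.
    by apply/seteqP; split=> w => [Aw|[k _ []//]]; exists (grid g N e w).
  apply: cpref_bigcup => // [k|]; first exact/mG/Gcell.
  apply/trivIsetP => i j _ _ /eqP ij; apply/seteqP; split=> // w [[_ /= wi] [_ /= wj]].
  by apply: ij; rewrite -wi.
split.
  (* On a cell with lower end [s], [f] is preferred to [s], which exceeds [g - e]; dually below,
     [g + e] is at least [s + e], which is preferred to [f]. *)
  apply: cpref_lim_r; auto => e e0; apply: (cells _ _ e); auto => k.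
  have mc := mG (Gcell e k e0).
  have itv w : cell e k w -> k%:R * e - N <= g w < k%:R * e - N + e.
    by move=> [_ <-]; exact: grid_itv.
  apply: (cpref_trans _ _ _ _ (lower _ (k%:R * e - N) (Gcell e k e0) _)); auto.
    by move=> w /itv/andP[].
  by apply: cpref_mono; auto => w /itv/andP[_ /=]; lra.
apply: cpref_lim_l; auto => e e0; apply: (cells _ _ e); auto => k.
have mc := mG (Gcell e k e0).
have itv w : cell e k w -> k%:R * e - N <= g w < k%:R * e - N + e.
  by move=> [_ <-]; exact: grid_itv.
apply: (cpref_trans _ _ _ _ _ (upper _ (k%:R * e - N + e) (Gcell e k e0) _)); auto.
  by apply: cpref_mono; auto => w /itv/andP[/= + _]; lra.
by move=> w /itv/andP[_ /ltW].
Qed.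

End conditional_certainty_equivalent.

Lemma conditionable_of_ST T : represents pref T -> conditionable T G.
Proof.
move=> rT f Lf; have [[M fM] _] := Lf.
have [g Lg fg] := conditional_equivalent Lf fM.
have LFg : LinfF g by case: Lg => bg mg; split=> // B mB; exact/mG/mg.
exists g; split=> // A GA; have mA := mG GA; have L0 := LinfF_cst 0.
rewrite !restr_mix; apply/(represents_eq rT); auto.
by have [h1 h2] := fg A GA; split; [exact: h1|exact: h2].
Qed.

End hahn.
End separability.
End preferences.

Theorem mainTheorem2 (d : measure_display) (Omega : measurableType d)
  (R : realType) (pref : (Omega -> R) -> (Omega -> R) -> Prop) :
  preference_order pref -> SM pref -> PC pref ->
  (ST pref <->
     (forall T : (Omega -> R) -> R, represents pref T ->
        forall G : set (set Omega), is_sub_sigma_algebra G -> conditionable T G)) /\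
  (ST pref <->
     (forall T : (Omega -> R) -> R, represents pref T ->
        forall A : set Omega, measurable A -> conditionable T (sigma_of A))).
Proof.
move=> po sm pc.
have i_ii : ST pref -> forall T, represents pref T ->
    forall G, is_sub_sigma_algebra G -> conditionable T G.
  by move=> st T rT G sG; exact: (conditionable_of_ST po sm pc st sG rT).
have iii_i := ST_of_conditionable po sm pc.
split; split=> //.
- move=> h; apply: iii_i => T rT A mA; apply: h => //.
  exact: sigma_of_sub_sigma_algebra.
- move=> st T rT A mA; apply: i_ii => //; exact: sigma_of_sub_sigma_algebra.
Qed.
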